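(* Let $(W,S)$ be a finite Coxeter system. Let $w\in W$ and $\phi,\psi\in S_W$. Then \[ \partial_w(\phi\psi)=\sum_{v\leq w}\bigl(\partial_v(\phi)\bigr)\bigl(v\,\partial_{w/v}(\psi)\bigr), \] where the sum is over all $v\in W$ with $v\leq w$ in the Bruhat order.
   Context: Coxeter setup. $(W,S)$ is a Coxeter system with $W$ finite; $m(s,s')$ is the order of $ss'$. $\mathfrak h_{\mathbb R}$ is a real vector space with basis $\Delta$ (the simple roots), in bijection with $S$ via $\beta\mapsto s_\beta$, with symmetric bilinear form $B(\beta,\beta')=-\cos(\pi/m(s_\beta,s_{\beta'}))$. $W$ acts by $s_\beta(x)=x-2B(x,\beta)\beta$, and $B$ is a $W$-invariant scalar product. $R=\{u(\beta):u\in W,\beta\in\Delta\}$ is the root system, $R^+$ the set of roots that are nonnegative linear combinations of $\Delta$. For $\alpha=u(\beta)\in R$, $s_\alpha=us_\beta u^{-1}$. $\ell$ is the length function, $\leq$ the (strong) Bruhat order. Products $\prod_{j\in J}$ over a finite set $J$ of integers are taken in increasing order of the index (empty product $=1$). Coinvariant algebra and operators. $\mathfrak h=\mathfrak h_{\mathbb R}\otimes\mathbb C$, $S(\mathfrak h)$ is the symmetric algebra with its $W$-action, $I_W$ the ideal generated by the $W$-invariant polynomials without constant term, and $S_W=S(\mathfrak h)/I_W$. For $\alpha\in R$, $\partial_\alpha=\frac{1-s_\alpha}{\alpha}$ is the $\mathbb C$-linear endomorphism of $S_W$ induced by $f\mapsto (f-s_\alpha f)/\alpha$ on $S(\mathfrak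 h)$. For $w\in W$ with reduced expression $s_{\beta_1}\cdots s_{\beta_\ell}$, $\partial_w=\partial_{\beta_1}\cdots\partial_{\beta_\ell}$ (independent of the reduced expression). Skew divided difference operators: for $v\leq w$, fix a reduced expression $s_{\beta_1}\cdots s_{\beta_\ell}$ of $w$; for $J\subseteq\{1,\ldots,\ell\}$ let $\partial_J=\delta_1\cdots\delta_\ell$, where $\delta_j=s_{\beta_j}$ (acting on $S_W$) if $j\in J$ and $\delta_j=\partial_{\beta_j}$ if $j\notin J$; then $\partial_{w/v}=v^{-1}\sum_J\partial_J$, the sum over all $J$ such that $\prod_{j\in J}s_{\beta_j}$ is a reduced expression of $v$ (independent of the reduced expression of $w$). For $v\not\leq w$, $\partial_{w/v}=0$. Elements of $W$ also denote the corresponding linear automorphisms of $S_W$. *)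

(* Defs.v *)
From HB Require Import structures.
From mathcomp Require Import all_boot all_order all_algebra all_fingroup.
From mathcomp Require Import boolp reals complex generic_quotient ring_quotient mpoly.
From mathcomp Require trigo.

Set Implicit Arguments.
Unset Strict Implicit.
Unset Printing Implicit Defensive.

Import GRing.Theory.
Local Open Scope ring_scope.
Local Open Scope quotient_scope.

Definition complexes (R : realType) : fieldType := R[i].

(* The second conjunct says that S generates W, the third that the relations
   (s t)^m(s,t) = 1, with m(s,t) the order of s t, present W: any assignment
   of the generators satisfying them in some (possibly infinite) group extends
   to a homomorphism. *)
Definition coxeter_system (W : finGroupType) (S : {set W}) : Prop :=
  [/\ forall s, s \in S -> #[s]%g = 2,
      <<S>>%g = [set: W] &
      forall (H : groupType) (f : W -> H),
        (forall s t, s \in S -> t \in S -> ((f s * f t) ^+ #[s * t] = 1)%g) ->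
        exists2 phi : W -> H,
          {morph phi : x y / (x * y)%g} & {in S, phi =1 f}].

Section CoxeterCombinatorics.
Variables (W : finGroupType) (S : {set W}) (cox : coxeter_system S).

(* The simple reflections are indexed by 'I_#|S|; words are sequences of
   indices. *)
Definition simple_refl (i : 'I_#|S|) : W := enum_val i.

Definition word_prod (a : seq 'I_#|S|) : W := (\prod_(i <- a) simple_refl i)%g.

Definition has_word (w : W) (k : nat) : bool :=
  [exists a : k.-tuple 'I_#|S|, word_prod a == w].

Lemma has_word_exists w : exists k, has_word w k.
Proof.
have [_ genS _] := cox.
have /gen_prodgP[k [c cS ->]] : w \in <<S>>%g by rewrite genS inE.
exists k; apply/existsP.
exists [tuple enum_rank_in (cS i) (c i) | i < k]; apply/eqP.
rewrite /word_prod big_tuple; apply: eq_bigr => i _.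
by rewrite tnth_mktuple /simple_refl enum_rankK_in.
Qed.

Definition len (w : W) : nat := ex_minn (has_word_exists w).

Definition reduced_expr (w : W) (a : seq 'I_#|S|) : bool :=
  (word_prod a == w) && (size a == len w).

Lemma reduced_expr_exists w : exists a, reduced_expr w a.
Proof.
rewrite /reduced_expr /len; case: ex_minnP => k /existsP[a aw] _.
by exists a; rewrite aw size_tuple eqxx.
Qed.

Definition redword (w : W) : seq 'I_#|S| := xchoose (reduced_expr_exists w).

Lemma redwordP w : reduced_expr w (redword w).
Proof. exact: xchooseP. Qed.

Lemma redword_simple_refl i : redword (simple_refl i) = [:: i].
Proof.
have [S2 _ _] := cox.
have /andP[/eqP ai /eqP si] := redwordP (simple_refl i).
have : (len (simple_refl i) <= 1)%N.
  rewrite /len; case: ex_minnP => k _; apply; apply/existsP.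
  by exists [tuple i]; rewrite /word_prod /= big_seq1.
rewrite -si; case: redword ai => [|j [|//]] /=.
  rewrite /word_prod big_nil => i1.
  by have := S2 _ (enum_valP i); rewrite -/(simple_refl i) -i1 order1.
by rewrite /word_prod big_seq1 => /enum_val_inj ->.
Qed.

Definition reflections : {set W} := [set (u * s * u^-1)%g | u in [set: W], s in S].

(* v <= w iff w is reached from v by right multiplications by reflections, each
   increasing the length. *)
Definition bruhat_le (v w : W) : bool :=
  connect (fun x y : W =>
    [exists t in reflections, y == (x * t)%g] && (len x < len y)%N) v w.

End CoxeterCombinatorics.

Section CoinvariantAlgebra.
Variables (R : realType) (W : finGroupType) (S : {set W}).
Variable cox : coxeter_system S.

Local Notation n := #|S|.
Local Notation h := 'rV[R]_n.
Local Notation Sh := {mpoly (complexes R)[n]}.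

Definition simple_root (i : 'I_n) : h := delta_mx 0 i.

Definition coxB (x y : h) : R :=
  \sum_i \sum_j
    x 0 i * y 0 j * - trigo.cos (trigo.pi / #[simple_refl i * simple_refl j]%g%:R).

Definition srefl (i : 'I_n) (x : h) : h :=
  x - (2 * coxB x (simple_root i)) *: simple_root i.

(* w acts as the composite of the simple reflections along an expression of w;
   the choice of the expression is immaterial since the srefl i satisfy the
   Coxeter relations. *)
Definition hact (w : W) (x : h) : h :=
  foldr (@srefl) x (redword cox w).

(* 'X_i stands for the i-th simple root. *)
Definition lin (x : h) : Sh := \sum_i ((x 0 i)%:C%C : complexes R) *: 'X_i.

Definition pact (w : W) (f : Sh) : Sh :=
  f \mPo [tuple lin (hact w (simple_root i)) | i < n].

Definition invariant (p : Sh) : Prop := forall w, pact w p = p.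

Definition IW_spec (f : Sh) : Prop :=
  exists (r : nat) (g p : 'I_r -> Sh),
    (forall k, invariant (p k) /\ (p k)@_0%MM = 0) /\
    f = \sum_k g k * p k.

Definition IW : {pred Sh} := fun f => `[< IW_spec f >].

Lemma IWP f : reflect (IW_spec f) (f \in IW).
Proof. exact: asboolP. Qed.

Lemma pactD w : {morph pact w : f g / f + g}.
Proof. exact: comp_mpolyD. Qed.

Lemma pactB w : {morph pact w : f g / f - g}.
Proof. exact: comp_mpolyB. Qed.

Lemma pactM w : {morph pact w : f g / f * g}.
Proof. by move=> f g; rewrite /pact rmorphM. Qed.

Lemma pactX w i : pact w 'X_i = lin (hact w (simple_root i)).
Proof. by rewrite /pact comp_mpolyXU -tnth_nth tnth_mktuple. Qed.

Lemma pact_sum w r (F : 'I_r -> Sh) :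
  pact w (\sum_k F k) = \sum_k pact w (F k).
Proof. by rewrite /pact raddf_sum. Qed.

Lemma hact_simple_refl i x : hact (simple_refl i) x = srefl i x.
Proof. by rewrite /hact redword_simple_refl. Qed.

Lemma lin_root i : lin (simple_root i) = 'X_i.
Proof.
rewrite /lin (bigD1 i) //= big1 => [|j /negPf ji]; rewrite mxE eqxx.
  by rewrite eqxx addr0 scale1r.
by rewrite ji scale0r.
Qed.

Lemma linB x y : lin (x - y) = lin x - lin y.
Proof.
rewrite /lin -sumrB; apply: eq_bigr => i _.
by rewrite !mxE rmorphB scalerBl.
Qed.

Lemma linZ c x : lin (c *: x) = c%:C%C *: lin x.
Proof.
rewrite /lin scaler_sumr; apply: eq_bigr => i _.
by rewrite !mxE rmorphM scalerA.
Qed.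

Lemma IW_idealr_closed : idealr_closed IW.
Proof.
split=> [||a f g /IWP[r [gf [pf [Hf ->]]]] /IWP[r' [gg [pg [Hg ->]]]]].
- by apply/IWP; exists 0%N, (fun=> 0), (fun=> 0); split; [case|rewrite big_ord0].
- apply/negP => /IWP[r [g [p [Hp]]]] /(congr1 (mcoeff 0%MM)) /eqP.
  rewrite mcoeff1 eqxx raddf_sum big1 ?oner_eq0 // => k _.
  by rewrite /= rmorphM /= (Hp k).2 mulr0.
- apply/IWP; exists (r + r')%N.
  exists (fun k => match split k with inl i => a * gf i | inr j => gg j end).
  exists (fun k => match split k with inl i => pf i | inr j => pg j end).
  split=> [k|]; first by case: split.
  rewrite big_split_ord mulr_sumr; congr (_ + _); apply: eq_bigr => k _.
    by rewrite (unsplitK (inl k)) mulrA.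
  by rewrite (unsplitK (inr k)).
Qed.

HB.instance Definition _ := isIdealr.Build Sh IW IW_idealr_closed.

Definition coinvariant : Type := {ideal_quot IW}.
HB.instance Definition _ := GRing.ComNzRing.on coinvariant.

Local Notation S_W := coinvariant.

Definition coinv_class (f : Sh) : S_W := \pi_{ideal_quot IW} f.

Lemma coinv_eqP f g : reflect (coinv_class f = coinv_class g) (f - g \in IW).
Proof. by rewrite Quotient.idealrBE; apply: eqP. Qed.

Lemma coinv_classM : {morph coinv_class : f g / f * g}.
Proof. exact: rmorphM. Qed.

Lemma coinv_reprK (x : S_W) : coinv_class (repr x) = x.
Proof. exact: generic_quotient.reprK. Qed.

(* The action on S_W induced by pact (see coinv_act_class). *)
Definition coinv_act (w : W) (x : S_W) : S_W := coinv_class (pact w (repr x)).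

Lemma coinv_act_class w f : coinv_act w (coinv_class f) = coinv_class (pact w f).
Proof.
apply/coinv_eqP; rewrite -pactB.
have /coinv_eqP/IWP[r [g [p [Hp ->]]]] := coinv_reprK (coinv_class f).
apply/IWP; exists r, (fun k => pact w (g k)), p; split=> //.
by rewrite pact_sum; apply: eq_bigr => k _; rewrite pactM (Hp k).1.
Qed.

Lemma mpolyX_ind (P : Sh -> Prop) :
  (forall u v, P u -> P v -> P (u * v)) -> P 1 -> (forall j, P 'X_j) ->
  forall m, P 'X_[m].
Proof.
move=> PM P1 PX m; rewrite mpolyXE_id.
elim/big_ind: _ => [|u v|j _]; [exact: P1|exact: PM|].
elim: (m j) => [|k IHk]; first by rewrite expr0.
by rewrite exprS; apply: PM.
Qed.

Lemma pdd_exists i f : exists g : Sh, 'X_i * g == f - pact (simple_refl i) f.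
Proof.
suff [g Hg] : exists g : Sh, 'X_i * g = f - pact (simple_refl i) f.
  by exists g; apply/eqP.
pose P (f : Sh) := exists g : Sh, 'X_i * g = f - pact (simple_refl i) f.
have PM u v : P u -> P v -> P (u * v).
  move=> [u' Hu] [v' Hv]; exists (u' * v + pact (simple_refl i) u * v').
  rewrite pactM mulrDr mulrA Hu mulrCA Hv.
  by rewrite mulrBl mulrBr addrA subrK.
have P1 : P 1 by exists 0; rewrite /pact comp_mpoly1 subrr mulr0.
have PXj j : P 'X_j.
  exists ((2 * coxB (simple_root j) (simple_root i))%:C%C)%:MP.
  rewrite pactX hact_simple_refl /srefl linB linZ !lin_root.
  by rewrite opprB addrC subrK -mul_mpolyC mulrC.
have PX := mpolyX_ind PM P1 PXj.
elim/mpolyind: f => [|c m p _ _ [g Hg]].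
  by exists 0; rewrite /pact comp_mpoly0 subrr mulr0.
have [g' Hg'] := PX m; exists (c *: g' + g).
rewrite mulrDr -scalerAr Hg' Hg pactD /pact comp_mpolyZ scalerBr.
by rewrite opprD addrACA.
Qed.

(* (f - s_i f) / beta_i, with beta_i the simple root 'X_i; the quotient is
   unique by pdd_uniq. *)
Definition pdd (i : 'I_n) (f : Sh) : Sh := xchoose (pdd_exists i f).

Lemma pddP i f : 'X_i * pdd i f = f - pact (simple_refl i) f.
Proof. exact/eqP/(xchooseP (pdd_exists i f)). Qed.

Local Opaque pdd.

Lemma pdd_uniq i f g : 'X_i * g = f - pact (simple_refl i) f -> g = pdd i f.
Proof.
rewrite -pddP; apply: mulfI; apply/eqP => /(congr1 (mcoeff U_(i))).
by rewrite mcoeffX eqxx mcoeff0 => /eqP; rewrite oner_eq0.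
Qed.

Lemma pddB i : {morph pdd i : f g / f - g}.
Proof.
move=> f g; apply/esym/pdd_uniq; rewrite pactB.
have distr (A : pzRingType) (x u v a b a' b' : A) :
    x * u = a - a' -> x * v = b - b' -> x * (u - v) = a - b - (a' - b').
  by move=> xu xv; rewrite mulrBr xu xv !opprD !opprK addrACA.
exact: distr (pddP i f) (pddP i g).
Qed.

(* The operator on S_W induced by pdd (see dd_class). *)
Definition dd (i : 'I_n) (x : S_W) : S_W := coinv_class (pdd i (repr x)).

Lemma dd_class i f : dd i (coinv_class f) = coinv_class (pdd i f).
Proof.
apply/coinv_eqP.
have /coinv_eqP/IWP[r [g [p [Hp E]]]] := coinv_reprK (coinv_class f).
apply/IWP; exists r, (fun k => pdd i (g k)), p; split=> //.
rewrite -pddB E; apply/esym/pdd_uniq; rewrite pact_sum -sumrB mulr_sumr.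
apply: eq_bigr => k _; rewrite pactM (Hp k).1.
have distr (A : pzRingType) (x u a a' b : A) :
    x * u = a - a' -> x * (u * b) = a * b - a' * b.
  by move=> xu; rewrite mulrA xu mulrBl.
exact: distr (pddP i (g k)).
Qed.

Definition dd_word (a : seq 'I_n) (x : S_W) : S_W := foldr dd x a.

(* Like skew_dd below, this does not depend on which reduced expression of w
   redword picks. *)
Definition dd_elt (w : W) : S_W -> S_W := dd_word (redword cox w).

(* The subset J of positions of the word a is encoded by a bit mask. *)
Definition dd_sub (a : seq 'I_n) (J : bitseq) (x : S_W) : S_W :=
  foldr (fun bi y => if bi.1 then coinv_act (simple_refl bi.2) y else dd bi.2 y)
    x (zip J a).

Definition skew_dd (w v : W) (x : S_W) : S_W :=
  let a := redword cox w in
  if bruhat_le cox v w then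
    coinv_act (v^-1)%g
      (\sum_(J : (size a).-tuple bool | reduced_expr cox v (mask J a))
         dd_sub a J x)
  else 0.

End CoinvariantAlgebra.

(* Main.v *)
Require Import Defs.
From HB Require Import structures.
From mathcomp Require Import all_boot all_order all_algebra all_fingroup.
From mathcomp Require Import boolp reals complex mpoly ring zify.
From mathcomp Require trigo.

(** Let a be a reduced word of w. Applying the twisted Leibniz rule
    dd_i (x y) = dd_i x * s_i y + x * dd_i y letter by letter expands
    dd_w (phi psi) into a sum over all subsets J of positions of a: the letters
    in J differentiate phi and reflect psi, the other letters differentiate psi
    only (dd_word_leibniz). The theorem is this expansion with the subsets
    grouped by the product v of the subword that they select, provided that

    - a subword that is not reduced contributes 0 (dd_word_eq0);
    - a reduced subword of product v contributes dd_v phi, whichever reduced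
      word of v it is (dd_word_reduced);
    - the product of a subword of a is below w in the Bruhat order
      (bruhat_le_mask);
    - v undoes the v^-1 in the definition of skew_dd (coinv_actVK), that is, the
      formula for the simple reflections does define an action of W (hactM).

    The last point is the computation that the geometric representation
    satisfies the Coxeter relations (srefl_braid), combined with the presentation
    of W. The other three rest on the positivity of roots (nonneg_root): every
    root is nonnegative or nonpositive, and u^-1 (a_i) is nonnegative when s_i u
    is longer than u. It follows that the positive roots made negative by w can
    be read off any reduced word of w, one for each letter (inversion_invs,
    invs_inversion). This gives strong exchange, hence the lifting property of
    the Bruhat order (bruhat_le_simple) and the third point.

    The first two points go back to Bernstein, Gelfand and Gelfand. The operator
    D_a of a word a satisfies D_a (f x) = D_a f * w(x) + sum of 2 B(x, b) D_c f for x
    linear, where c runs over the words obtained by deleting a letter of a and b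
    is the inversion attached to that letter (pdd_word_lin). By induction on the
    length, D_c depends only on the product of c, and the pairs of an inversion
    b and its reflection depend only on w; thus two reduced words a, a' of w
    obey the same rule. As D_a and D_a' also agree at 1, they are equal. *)

Set Implicit Arguments.
Unset Strict Implicit.
Unset Printing Implicit Defensive.

Import Order.TTheory GRing.Theory Num.Theory.
Local Open Scope ring_scope.

(** * The group of bijections of a type *)

Section Bijections.
Variable T : Type.

(** The universal property of the Coxeter presentation is applied to this group
    for T the space spanned by the simple roots. Elements carry their inverse as
    data, which makes inversion in the group an exchange of two fields. *)
Record bij := Bij {
  bij_fun : T -> T;
  bij_inv : T -> T;
  bij_funK : cancel bij_fun bij_inv;
  bij_invK : cancel bij_inv bij_fun }.

HB.instance Definition _ := gen_eqMixin bij.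
HB.instance Definition _ := gen_choiceMixin bij.

Lemma bij_ext f g : bij_fun f =1 bij_fun g -> f = g.
Proof.
case: f g => f f' fK f'K [g g' gK g'K] /= fg.
have E : f = g by apply/funext.
have E' : f' = g' by apply/funext => x; rewrite -[x in LHS]g'K -fg fK.
by subst g g'; congr Bij; apply: Prop_irrelevance.
Qed.

Definition bij_one := @Bij id id (fun=> erefl) (fun=> erefl).
Definition bij_mul f g :=
  Bij (can_comp (bij_funK f) (bij_funK g)) (can_comp (bij_invK g) (bij_invK f)).
Definition bij_opp f := Bij (bij_invK f) (bij_funK f).

Fact bij_mulA : associative bij_mul. Proof. by move=> f g k; apply: bij_ext. Qed.
Fact bij_mul1 : left_id bij_one bij_mul. Proof. by move=> f; apply: bij_ext. Qed.
Fact bij_mulr1 : right_id bij_one bij_mul.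
Proof. by move=> f; apply: bij_ext. Qed.
Fact bij_mulV : left_inverse bij_one bij_opp bij_mul.
Proof. by move=> f; apply: bij_ext => x /=; rewrite bij_funK. Qed.
Fact bij_mulrV : right_inverse bij_one bij_opp bij_mul.
Proof. by move=> f; apply: bij_ext => x /=; rewrite bij_invK. Qed.

HB.instance Definition _ :=
  isGroup.Build bij bij_mulA bij_mul1 bij_mulr1 bij_mulV bij_mulrV.

Lemma bij_funM (f g : bij) x : bij_fun (f * g)%g x = bij_fun f (bij_fun g x).
Proof. by []. Qed.

Lemma bij_funX (f : bij) k x : bij_fun (f ^+ k)%g x = iter k (bij_fun f) x.
Proof. by elim: k => // k IHk; rewrite expgS bij_funM IHk. Qed.

End Bijections.

(** * The geometric representation *)

Section Geometry.
Variables (R : realType) (W : finGroupType) (S : {set W}).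
Variable cox : coxeter_system S.

Local Notation n := #|S|.
Local Notation h := 'rV[R]_n.
Local Notation rt := (simple_root R).
Implicit Types (i j : 'I_n) (x y z : h).

Definition coxm i j : nat := #[simple_refl i * simple_refl j]%g.
Definition angle i j : R := trigo.pi / (coxm i j)%:R.

Lemma coxmC i j : coxm i j = coxm j i.
Proof.
by rewrite /coxm -[LHS](orderJ _ (simple_refl i)) conjgE -!mulgA mulKg.
Qed.

Lemma angleC i j : angle i j = angle j i.
Proof. by rewrite /angle coxmC. Qed.

Lemma simple_refl2 i : (simple_refl i * simple_refl i = 1)%g.
Proof.
have [S2 _ _] := cox.
by have E := S2 _ (enum_valP i); rewrite -[1%g](expg_order (simple_refl i)) E.
Qed.

Lemma simple_reflV i : ((simple_refl i)^-1 = simple_refl i)%g.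
Proof. by apply/eqP; rewrite eq_invg_mul simple_refl2. Qed.

Lemma coxm_gt1 i j : i != j -> (1 < coxm i j)%N.
Proof.
move=> ij; rewrite order_gt1; apply: contra ij.
by rewrite -eq_invg_mul simple_reflV => /eqP/enum_val_inj ->.
Qed.

Lemma coxBC x y : coxB x y = coxB y x.
Proof.
rewrite /coxB exchange_big; apply: eq_bigr => i _; apply: eq_bigr => j _.
by rewrite -/(coxm j i) coxmC [x 0 j * _]mulrC.
Qed.

Lemma coxBDl x y z : coxB (x + y) z = coxB x z + coxB y z.
Proof.
rewrite /coxB -big_split; apply: eq_bigr => i _; rewrite -big_split.
by apply: eq_bigr => j _ /=; rewrite !mxE !mulrDl.
Qed.

Lemma coxBZl c x y : coxB (c *: x) y = c * coxB x y.
Proof.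
rewrite /coxB mulr_sumr; apply: eq_bigr => i _; rewrite mulr_sumr.
by apply: eq_bigr => j _; rewrite !mxE !mulrA.
Qed.

Lemma coxBDr x y z : coxB x (y + z) = coxB x y + coxB x z.
Proof. by rewrite coxBC coxBDl !(coxBC x). Qed.

Lemma coxBZr c x y : coxB x (c *: y) = c * coxB x y.
Proof. by rewrite coxBC coxBZl (coxBC x). Qed.

Lemma coxBNl x y : coxB (- x) y = - coxB x y.
Proof. by rewrite -scaleN1r coxBZl mulN1r. Qed.

Lemma coxBNr x y : coxB x (- y) = - coxB x y.
Proof. by rewrite coxBC coxBNl coxBC. Qed.

Definition coxBE := (coxBDl, coxBDr, coxBNl, coxBNr, coxBZl, coxBZr).

Lemma coxB_rt i j : coxB (rt i) (rt j) = - trigo.cos (angle i j).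
Proof.
rewrite /coxB (bigD1 i) //= (bigD1 j) //= !big1 ?addr0.
- by rewrite !mxE !eqxx !mul1r.
- by move=> k /negPf ki; apply: big1 => l _; rewrite !mxE ki !mul0r.
- by move=> k /negPf ki; rewrite !mxE ki mulr0 mul0r.
Qed.

Lemma coxB_rt_refl i : coxB (rt i) (rt i) = 1.
Proof.
by rewrite coxB_rt /angle /coxm simple_refl2 order1 divr1 trigo.cospi opprK.
Qed.

Lemma sreflD i x y : srefl i (x + y) = srefl i x + srefl i y.
Proof. by rewrite /srefl coxBE mulrDr scalerDl opprD addrACA. Qed.

Lemma sreflZ i c x : srefl i (c *: x) = c *: srefl i x.
Proof. by rewrite /srefl coxBE scalerBr scalerA mulrCA. Qed.

Lemma srefl_rt i : srefl i (rt i) = - rt i.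
Proof. by rewrite /srefl coxB_rt_refl mulr1 scaler_nat mulr2n opprD addNKr. Qed.

Lemma sreflK i : involutive (@srefl R W S i).
Proof.
move=> x; rewrite {1}/srefl {2}/srefl !coxBE coxB_rt_refl.
by apply/rowP => k; rewrite /srefl !mxE; ring.
Qed.

Lemma coxB_srefl i x y : coxB (srefl i x) (srefl i y) = coxB x y.
Proof. by rewrite /srefl !coxBE coxB_rt_refl (coxBC (rt i) y); ring. Qed.

Lemma srefl_plane i j p q :
  srefl j (p *: rt i + q *: rt j) =
  p *: rt i + (2 * trigo.cos (angle i j) * p - q) *: rt j.
Proof.
rewrite sreflD !sreflZ srefl_rt /srefl coxB_rt.
by apply/rowP => k; rewrite !mxE; ring.
Qed.

(** Reading each letter off the parity of its position gives access to both ends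
    of the alternating word: altS peels off the first letter, altSr the last. *)
Definition alt i j k : seq 'I_n := mkseq (fun l => if odd l then j else i) k.

Lemma altSr i j k : alt i j k.+1 = rcons (alt i j k) (if odd k then j else i).
Proof. exact: mkseqS. Qed.

Lemma altS i j k : alt i j k.+1 = i :: alt j i k.
Proof.
rewrite /alt /mkseq /= -[1%N]/(1 + 0)%N iotaDl -map_comp; congr (_ :: _).
by apply: eq_map => l /=; case: odd.
Qed.

Lemma size_alt i j k : size (alt i j k) = k.
Proof. exact: size_mkseq. Qed.

Lemma sin_angle_gt0 i j : i != j -> 0 < trigo.sin (angle i j).
Proof.
move=> /coxm_gt1 m1; apply: trigo.sin_gt0_pi; rewrite /angle.
have m0 : 0 < (coxm i j)%:R :> R by rewrite ltr0n (ltn_trans _ m1).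
rewrite divr_gt0 ?trigo.pi_gt0 //= ltr_pdivrMr // ltr_pMr ?trigo.pi_gt0 //.
by rewrite ltr1n.
Qed.

Lemma sin_step (t : R) k :
  trigo.sin (k.+2%:R * t) =
  2 * trigo.cos t * trigo.sin (k.+1%:R * t) - trigo.sin (k%:R * t).
Proof.
have -> : k.+2%:R * t = k.+1%:R * t + t :> R by rewrite -[k.+2]addn1 natrD; ring.
have -> : k%:R * t = k.+1%:R * t - t :> R by rewrite -[k.+1]addn1 natrD; ring.
by rewrite trigo.sinD trigo.sinB; ring.
Qed.

Definition wact (a : seq 'I_n) x : h := foldr (@srefl R W S) x a.

Lemma wact_cat a b x : wact (a ++ b) x = wact a (wact b x).
Proof. exact: foldr_cat. Qed.

Definition sin_mul i j l : R := trigo.sin (l%:R * angle i j).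

Lemma sin_mul0 i j : sin_mul i j 0 = 0.
Proof. by rewrite /sin_mul mul0r trigo.sin0. Qed.

Lemma sin_mulSS i j l :
  sin_mul i j l.+2 =
  2 * trigo.cos (angle i j) * sin_mul i j l.+1 - sin_mul i j l.
Proof. exact: sin_step. Qed.

Lemma sin_mul1_gt0 i j : i != j -> 0 < sin_mul i j 1.
Proof. by move=> ij; rewrite /sin_mul mul1r sin_angle_gt0. Qed.

(** The plane of the two roots is a Euclidean plane on which the two reflections
    generate a dihedral group; this is the rotated root in the basis of simple
    roots, scaled by sin(pi / m) to avoid a division. It serves twice: at
    k = 2m for the braid relation, and at k < m for the positivity of roots. *)
Lemma wact_alt i j k :
  sin_mul i j 1 *: wact (rev (alt j i k)) (rt i) =
  if odd k then sin_mul i j k *: rt i + sin_mul i j k.+1 *: rt j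
  else sin_mul i j k.+1 *: rt i + sin_mul i j k *: rt j.
Proof.
elim: k => [|k IHk] /=.
  by rewrite sin_mul0 scale0r addr0.
rewrite altSr rev_rcons /= -sreflZ IHk.
case: (odd k) => /=; last by rewrite srefl_plane sin_mulSS.
by rewrite addrC srefl_plane angleC sin_mulSS addrC.
Qed.

Lemma sin_mul_period i j (k := coxm i j) :
  sin_mul i j k.*2 = 0 /\ sin_mul i j k.*2.+1 = sin_mul i j 1.
Proof.
have E : k.*2%:R * angle i j = trigo.pi *+ 2 :> R.
  rewrite /angle -/k -muln2 natrM mulrAC mulrCA divff ?mulr1 ?mulr_natr //.
  by rewrite pnatr_eq0 -lt0n order_gt0.
rewrite /sin_mul E trigo.sin2pi; split=> //.
by rewrite -addn1 natrD mulrDl E addrC trigo.sinD2pi.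
Qed.

Lemma wact_alt_period i j : i != j ->
  wact (rev (alt j i (coxm i j).*2)) (rt i) = rt i.
Proof.
move=> ij; have [E0 E1] := sin_mul_period i j.
have := wact_alt i j (coxm i j).*2.
rewrite E0 E1 odd_double scale0r addr0.
by apply: scalerI; rewrite gt_eqF ?sin_mul1_gt0.
Qed.

Lemma wact_alt_iter i j k x :
  wact (rev (alt j i k.*2)) x = iter k (fun y => srefl i (srefl j y)) x.
Proof.
elim: k => //= k IHk.
by rewrite !altSr !rev_rcons /= !odd_double IHk.
Qed.

(** The Coxeter relation: the rotation fixes both roots by periodicity of the
    sine, and it fixes the orthogonal of their plane. *)
Lemma srefl_braid i j x :
  iter (coxm i j) (fun y => srefl i (srefl j y)) x = x.
Proof.
have [<-|ij] := eqVneq i j.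
  by rewrite /coxm simple_refl2 order1 /= sreflK.
set r := fun y => _; set m := coxm i j.
have rD y z : iter m r (y + z) = iter m r y + iter m r z.
  by elim: (m) => //= k ->; rewrite /r (sreflD j) (sreflD i).
have rZ c y : iter m r (c *: y) = c *: iter m r y.
  by elim: (m) => //= k ->; rewrite /r !sreflZ.
have ri : iter m r (rt i) = rt i by rewrite -wact_alt_iter wact_alt_period.
have rj : iter m r (rt j) = rt j.
  have := wact_alt_period (i := j) (j := i).
  rewrite eq_sym ij coxmC -/m wact_alt_iter.
  set r' := fun y => _; move=> /(_ isT) {1}<-.
  have rr' y : r (r' y) = y by rewrite /r /r' !sreflK.
  elim: (m) => //= k IHk; rewrite -iterS iterSr.
  by rewrite rr' IHk.
(* Subtracting from x its orthogonal projection p a_i + q a_j to the plane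
   leaves a vector y fixed by both reflections. The projection exists because
   the Gram determinant d is sin(pi / m) squared, which is not 0. *)
set c := trigo.cos (angle i j); set d := 1 - c ^+ 2.
have d0 : d != 0.
  by rewrite /d -trigo.sin2cos2 expf_neq0 // gt_eqF ?sin_angle_gt0.
set u := coxB x (rt i); set v := coxB x (rt j).
set p := (u + c * v) / d; set q := (v + c * u) / d.
pose y := x - (p *: rt i + q *: rt j).
have yi : coxB y (rt i) = 0.
  rewrite /y !coxBE coxB_rt_refl coxB_rt angleC -/c -/u /p /q.
  by rewrite /d; field; rewrite -/d.
have yj : coxB y (rt j) = 0.
  rewrite /y !coxBE coxB_rt_refl coxB_rt -/c -/v /p /q.
  by rewrite /d; field; rewrite -/d.
have ry : iter m r y = y.
  elim: (m) => //= k ->; rewrite /r.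
  by rewrite {2}/srefl yj mulr0 scale0r subr0 /srefl yi mulr0 scale0r subr0.
have -> : x = y + (p *: rt i + q *: rt j) by rewrite subrK.
by rewrite (rD y) ry (rD (p *: _)) !rZ ri rj.
Qed.

Definition srefl_bij i : bij h := Bij (@sreflK i) (@sreflK i).

(** The Coxeter presentation turns the relations srefl_braid into an action of
    W, which makes hact independent of the chosen reduced words. *)
Lemma hact_morph : exists2 phi : W -> bij h,
  {morph phi : u v / (u * v)%g} & forall i, phi (simple_refl i) = srefl_bij i.
Proof.
have [_ _ univ] := cox.
pose f (s : W) : bij h :=
  if [pick i | simple_refl i == s] is Some i then srefl_bij i else 1%g.
have fE i : f (simple_refl i) = srefl_bij i.
  rewrite /f; case: pickP => [j /eqP/enum_val_inj -> //|/(_ i)].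
  by rewrite eqxx.
have [|phi phiM phiE] := univ _ f.
  move=> s t sS tS.
  have [i Ei] : exists i, s = simple_refl i.
    by exists (enum_rank_in sS s); rewrite /simple_refl enum_rankK_in.
  have [j Ej] : exists i, t = simple_refl i.
    by exists (enum_rank_in tS t); rewrite /simple_refl enum_rankK_in.
  rewrite Ei Ej !fE; apply: bij_ext => x; rewrite bij_funX.
  exact: srefl_braid.
by exists phi => // i; rewrite phiE ?fE ?enum_valP.
Qed.

Lemma word_prod_nil : word_prod ([::] : seq 'I_n) = 1%g.
Proof. exact: big_nil. Qed.

Lemma word_prod_cons i (a : seq 'I_n) :
  word_prod (i :: a) = (simple_refl i * word_prod a)%g.
Proof. exact: big_cons. Qed.

Lemma word_prod_cat (a b : seq 'I_n) :
  word_prod (a ++ b) = (word_prod a * word_prod b)%g.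
Proof. exact: big_cat. Qed.

Lemma word_prod_redword w : word_prod (redword cox w) = w.
Proof. by have /andP[/eqP] := redwordP cox w. Qed.

Lemma size_redword w : size (redword cox w) = len cox w.
Proof. by have /andP[_ /eqP] := redwordP cox w. Qed.

Lemma hact_word a x : hact cox (word_prod a) x = wact a x.
Proof.
have [phi phiM phiE] := hact_morph.
have phi1 : phi 1%g = 1%g by apply: (mulgI (phi 1%g)); rewrite -phiM !mulg1.
have wactE b y : wact b y = bij_fun (phi (word_prod b)) y.
  elim: b => [|i b IHb]; first by rewrite word_prod_nil phi1.
  by rewrite word_prod_cons phiM phiE bij_funM -IHb.
by rewrite -[LHS]/(wact _ _) !wactE word_prod_redword.
Qed.

Lemma hactM u v x : hact cox (u * v)%g x = hact cox u (hact cox v x).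
Proof.
rewrite -[u]word_prod_redword -[v]word_prod_redword -word_prod_cat.
by rewrite !hact_word wact_cat.
Qed.

Lemma hact1 x : hact cox 1%g x = x.
Proof. by rewrite -[1%g]word_prod_nil hact_word. Qed.

Lemma hactK u : cancel (hact cox u) (hact (R := R) cox u^-1%g).
Proof. by move=> x; rewrite -hactM mulVg hact1. Qed.

Lemma hactVK u : cancel (hact cox u^-1%g) (hact (R := R) cox u).
Proof. by move=> x; rewrite -hactM mulgV hact1. Qed.

Lemma hactD u x y : hact cox u (x + y) = hact cox u x + hact cox u y.
Proof.
rewrite -[u]word_prod_redword !hact_word.
by elim: (redword _ _) => //= i a ->; rewrite sreflD.
Qed.

Lemma hactZ u c x : hact cox u (c *: x) = c *: hact cox u x.
Proof.
rewrite -[u]word_prod_redword !hact_word.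
by elim: (redword _ _) => //= i a ->; rewrite sreflZ.
Qed.

Lemma hactN u x : hact cox u (- x) = - hact cox u x.
Proof. by rewrite -scaleN1r hactZ scaleN1r. Qed.

Lemma coxB_hact u x y : coxB (hact cox u x) (hact cox u y) = coxB x y.
Proof.
rewrite -[u]word_prod_redword !hact_word.
by elim: (redword _ _) => //= i a <-; rewrite coxB_srefl.
Qed.

Lemma hact_refl u i x :
  hact cox (u * simple_refl i * u^-1)%g x =
  x - (2 * coxB x (hact cox u (rt i))) *: hact cox u (rt i).
Proof.
rewrite !hactM hact_simple_refl /srefl hactD hactN hactZ hactVK.
by rewrite -[x in RHS](hactVK u) coxB_hact hactVK.
Qed.

End Geometry.

(** * Length and alternating words *)

Section Length.
Variables (W : finGroupType) (S : {set W}).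
Variable cox : coxeter_system S.

Local Notation n := #|S|.
Local Notation len := (len cox).
Local Notation sr := (@simple_refl W S).
Implicit Types (i j : 'I_n) (a b : seq 'I_n) (u v w : W).

Lemma simple_reflK i : involutive (mulg (sr i)).
Proof. by move=> u; rewrite mulgA (simple_refl2 cox) mul1g. Qed.

Lemma len_word a : (len (word_prod a) <= size a)%N.
Proof.
rewrite /Defs.len; case: ex_minnP => k _; apply; apply/existsP.
by exists (in_tuple a).
Qed.

Lemma word_prod_rev a : word_prod (rev a) = (word_prod a)^-1%g.
Proof.
elim: a => [|i a IHa]; first by rewrite word_prod_nil invg1.
rewrite rev_cons -cats1 word_prod_cat IHa !word_prod_cons word_prod_nil mulg1.
by rewrite invMg (simple_reflV cox).
Qed.

Lemma len_simple_le i w : (len (sr i * w)%g <= (len w).+1)%N.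
Proof.
have := len_word (i :: redword cox w).
by rewrite word_prod_cons word_prod_redword /= size_redword.
Qed.

Lemma len_simple_ge i w : (len w <= (len (sr i * w)%g).+1)%N.
Proof. by rewrite -[w in X in (X <= _)%N](simple_reflK i) len_simple_le. Qed.

(** Sending every simple reflection to the transposition of bool satisfies the
    Coxeter relations, which yields the sign character of W. *)
Lemma odd_len_word a : odd (len (word_prod a)) = odd (size a).
Proof.
have [S2 _ univ] := cox.
pose g : {perm bool} := tperm true false.
have [s t _ _|phi phiM phiE] := univ {perm bool} (fun=> g).
  by rewrite tperm2 expg1n.
have phi1 : phi 1%g = 1%g by apply: (mulgI (phi 1%g)); rewrite -phiM !mulg1.
have parity b : phi (word_prod b) true = ~~ odd (size b).
  have -> : phi (word_prod b) = (g ^+ size b)%g.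
    elim: b => [|i b IHb] /=; first by rewrite word_prod_nil phi1.
    by rewrite word_prod_cons phiM phiE ?enum_valP // IHb expgS.
  elim: (size b) => [|k IHk]; first by rewrite expg0 perm1.
  by rewrite expgSr permM IHk /=; case: odd; rewrite ?tpermL ?tpermR.
apply: negb_inj; rewrite -parity -[in RHS](word_prod_redword cox (word_prod a)).
by rewrite parity size_redword.
Qed.

Lemma odd_len_simple i w : odd (len (sr i * w)%g) = ~~ odd (len w).
Proof.
by rewrite -[w](word_prod_redword cox) -word_prod_cons !odd_len_word.
Qed.

Lemma len_simpleP i w :
  (len (sr i * w)%g == (len w).+1) (+) (len w == (len (sr i * w)%g).+1).
Proof.
have := len_simple_le i w; have := len_simple_ge i w.
have := odd_len_simple i w; lia.
Qed.

Lemma len_simple_down i w :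
  ~~ (len w < len (sr i * w)%g)%N -> len w = (len (sr i * w)%g).+1.
Proof. have := len_simpleP i w; lia. Qed.

Definition reduced a := len (word_prod a) == size a.

Lemma reduced_redword w : reduced (redword cox w).
Proof. by rewrite /reduced word_prod_redword size_redword. Qed.

Lemma reduced_cons i b :
  reduced (i :: b) =
  reduced b && (len (word_prod b) < len (sr i * word_prod b)%g)%N.
Proof.
rewrite /reduced word_prod_cons /=.
have := len_simpleP i (word_prod b); have := len_word b.
move: (len _) (len (_ * _)%g) (size b) => p q r.
by move=> le_b P; apply/idP/idP => [|/andP[]]; lia.
Qed.

(** At k = m(i, j) the power is 1, and this is the braid relation between the
    two alternating words of length m(i, j). *)
Lemma word_prod_altC i j k :
  word_prod (alt i j k) = ((sr i * sr j) ^+ k * word_prod (alt j i k))%g.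
Proof.
elim: k i j => [|k IHk] i j; first by rewrite expg0 mul1g.
rewrite !altS !word_prod_cons IHk !mulgA; congr (_ * _)%g.
elim: k {IHk} => [|k IHk].
  by rewrite expg0 expg1 mulg1 -mulgA (simple_refl2 cox) mulg1.
by rewrite expgSr !mulgA IHk [in RHS]expgSr -!mulgA simple_reflK
  (simple_refl2 cox) mulg1.
Qed.

(** The decomposition of v along the dihedral subgroup of i and j: letters i and
    j are stripped alternately from the left as long as this shortens v, so that
    what remains is minimal in its coset. *)
Lemma alt_strip i j v : (len v < len (sr j * v)%g)%N ->
  exists k v', [/\ v = (word_prod (alt i j k) * v')%g, len v = (k + len v')%N,
    (len v' < len (sr i * v')%g)%N & (len v' < len (sr j * v')%g)%N].
Proof.
have [k] := ubnP (len v); elim: k => // k IHk in i j v * => lt_vk up_j.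
have [up_i|/len_simple_down Ei] := boolP (len v < len (sr i * v)%g)%N.
  by exists 0, v; split=> //; rewrite word_prod_nil mul1g.
have [||l [v' [Ev El up_j' up_i']]] := IHk j i (sr i * v)%g _ _.
- by move: lt_vk; rewrite Ei ltnS.
- by rewrite simple_reflK Ei.
exists l.+1, v'; split=> //; last by rewrite Ei El.
by rewrite altS word_prod_cons -mulgA -Ev simple_reflK.
Qed.

(** An alternating prefix of length m(i, j) or more could be rewritten by the
    braid relation to start with i, and then i would shorten u. *)
Lemma alt_bound i j k u v :
  (len u < len (sr i * u)%g)%N -> u = (word_prod (alt j i k) * v)%g ->
  len u = (k + len v)%N -> (k < coxm i j)%N.
Proof.
move=> up Eu El; rewrite ltnNge; apply/negP => le_mk.
have m_gt0 : (0 < coxm i j)%N by rewrite order_gt0.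
pose b := drop (coxm i j) (alt j i k).
have Ealt : alt j i k = alt j i (coxm i j) ++ b.
  rewrite -[LHS](cat_take_drop (coxm i j)); congr (_ ++ _).
  rewrite /alt /mkseq -map_take; congr map.
  by rewrite take_iota (minn_idPl le_mk).
have Em : word_prod (alt j i (coxm i j)) = word_prod (alt i j (coxm i j)).
  by rewrite word_prod_altC coxmC expg_order mul1g.
have : (sr i * u)%g =
    word_prod (alt j i (coxm i j).-1 ++ b ++ redword cox v).
  rewrite Eu Ealt !word_prod_cat Em -[in LHS](prednK m_gt0) altS.
  by rewrite word_prod_cons word_prod_redword -!mulgA simple_reflK.
move=> Esu; have := len_word (alt j i (coxm i j).-1 ++ b ++ redword cox v).
rewrite -Esu !size_cat size_alt size_redword size_drop size_alt.
lia.
Qed.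

End Length.

(** * Roots and inversions *)

Section Roots.
Variables (R : realType) (W : finGroupType) (S : {set W}).
Variable cox : coxeter_system S.

Local Notation n := #|S|.
Local Notation h := 'rV[R]_n.
Local Notation rt := (simple_root R).
Local Notation len := (len cox).
Local Notation sr := (@simple_refl W S).
Local Notation hact := (hact cox).
Implicit Types (i j : 'I_n) (x y z : h) (a b : seq 'I_n) (u v w t : W).

Definition nonneg x := [forall k, 0 <= x 0 k].

Lemma nonnegP x : reflect (forall k, 0 <= x 0 k) (nonneg x).
Proof. exact: forallP. Qed.

Lemma nonneg_rt i : nonneg (rt i).
Proof. by apply/nonnegP => k; rewrite mxE ler0n. Qed.

Lemma nonnegD x y : nonneg x -> nonneg y -> nonneg (x + y).
Proof.
by move=> /nonnegP x0 /nonnegP y0; apply/nonnegP => k; rewrite mxE addr_ge0.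
Qed.

Lemma nonnegZ c x : 0 <= c -> nonneg x -> nonneg (c *: x).
Proof.
by move=> c0 /nonnegP x0; apply/nonnegP => k; rewrite mxE mulr_ge0.
Qed.

Lemma nonnegZ_pos c x : 0 < c -> nonneg (c *: x) = nonneg x.
Proof.
by move=> c0; apply: eq_forallb => k; rewrite mxE pmulr_rge0.
Qed.

Lemma sin_mul_ge0 i j k : (k <= coxm i j)%N -> 0 <= sin_mul R i j k.
Proof.
move=> le_km; apply: trigo.sin_ge0_pi; rewrite /angle.
have m0 : 0 < (coxm i j)%:R :> R by rewrite ltr0n order_gt0.
rewrite mulr_ge0 ?divr_ge0 ?ler0n ?trigo.pi_ge0 //= mulrA ler_pdivrMr //.
by rewrite mulrC ler_wpM2l ?trigo.pi_ge0 ?ler_nat.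
Qed.

Lemma hactV_word a x : hact (word_prod a)^-1%g x = wact (rev a) x.
Proof. by rewrite -(word_prod_rev cox) hact_word. Qed.

(** Positivity of roots, by induction on the length of u. Let j be the first
    letter of a reduced word of u, and strip from u a maximal alternating prefix
    in i and j: the remainder v is shorter and is lengthened by both i and j, so v^-1 sends both simple roots
    to nonnegative vectors, and the prefix sends the root of i to a nonnegative
    combination of the two, since all angles in wact_alt are at most pi. *)
Lemma nonneg_root u i :
  (len u < len (sr i * u)%g)%N -> nonneg (hact u^-1%g (rt i)).
Proof.
have [k] := ubnP (len u); elim: k => // k IHk in u i * => lt_uk up_i.
case Er: (redword cox u) => [|j b].
  by rewrite -[u](word_prod_redword cox) Er word_prod_nil invg1 hact1 nonneg_rt.
have down_j : ~~ (len u < len (sr j * u)%g)%N.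
  have -> : (sr j * u = word_prod b)%g.
    by rewrite -[u](word_prod_redword cox) Er word_prod_cons (simple_reflK cox).
  by rewrite -leqNgt (leq_trans (len_word cox b)) // -(size_redword cox u) Er /=.
have ij : i != j by apply: contraNneq down_j => <-.
have [l [v [Eu El up_j' up_i']]] := alt_strip j up_i.
have lm := alt_bound up_i Eu El.
have lt_vk : (len v < k)%N.
  case: l El Eu {lm} => [|l] El Eu; last by move: lt_uk; rewrite El; lia.
  by move: down_j; rewrite Eu word_prod_nil mul1g up_j'.
have vi := IHk v i lt_vk up_i'; have vj := IHk v j lt_vk up_j'.
rewrite -(nonnegZ_pos _ (sin_mul1_gt0 R cox ij)) Eu invMg hactM hactV_word.
rewrite -hactZ (wact_alt _ cox).
have sl := sin_mul_ge0 (ltnW lm); have sl1 := sin_mul_ge0 lm.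
by case: odd; rewrite hactD !hactZ nonnegD ?nonnegZ.
Qed.

(** A root together with its reflection. Since the root determines the reflection
    (root_pair_inj), this only saves inverting that correspondence. *)
Definition root_pair (p : h * W) :=
  exists u i, p = (hact u (rt i), (u * sr i * u^-1)%g).

Lemma root_pair_hact v x t :
  root_pair (x, t) -> root_pair (hact v x, (v * t * v^-1)%g).
Proof.
move=> [u [i [-> ->]]]; exists (v * u)%g, i.
by rewrite hactM invMg !mulgA.
Qed.

Lemma root_pairN x t : root_pair (x, t) -> root_pair (- x, t).
Proof.
move=> [u [i [-> ->]]]; exists (u * sr i)%g, i.
rewrite hactM hact_simple_refl (srefl_rt _ cox) hactN invMg -!mulgA.
by rewrite (simple_reflV cox) (simple_reflK cox).
Qed.

Lemma root_pair_reflE x t y :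
  root_pair (x, t) -> hact t y = y - (2 * coxB y x) *: x.
Proof. by move=> [u [i [-> ->]]]; apply: hact_refl. Qed.

Lemma root_pair_norm x t : root_pair (x, t) -> coxB x x = 1.
Proof. by move=> [u [i [-> _]]]; rewrite coxB_hact (coxB_rt_refl _ cox). Qed.

Lemma root_pairK x t : root_pair (x, t) -> (t * t = 1)%g.
Proof.
move=> [u [i [_ ->]]]; rewrite -!mulgA mulKg.
by rewrite (simple_reflK cox) mulgV.
Qed.

Lemma root_pair_hactN x t : root_pair (x, t) -> hact t x = - x.
Proof.
move=> xt; rewrite (root_pair_reflE _ xt) (root_pair_norm xt).
by apply/rowP => k; rewrite !mxE; ring.
Qed.

Lemma root_pairP v i : root_pair (hact v (rt i), (v * sr i * v^-1)%g).
Proof. by exists v, i. Qed.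

(** Every root is either nonnegative or nonpositive: for u (a_i), either i
    lengthens u^-1, or it lengthens s_i u^-1. *)
Lemma nonneg_rootN x t : root_pair (x, t) -> nonneg (- x) = ~~ nonneg x.
Proof.
move=> xt; apply/idP/idP => [/nonnegP xN|].
  apply/negP => /nonnegP xP; have := root_pair_norm xt.
  have -> : x = 0.
    apply/rowP => k; apply/eqP; rewrite mxE eq_le xP -oppr_ge0.
    by have := xN k; rewrite mxE => ->.
  by rewrite -(scale0r (0 : h)) coxBZl mul0r => /eqP; rewrite eq_sym oner_eq0.
case: xt => u [i [-> _]].
have [up|/len_simple_down down] :=
    boolP (len u^-1%g < len (sr i * u^-1)%g)%N.
  by have := nonneg_root up; rewrite invgK => ->.
have := @nonneg_root (sr i * u^-1)%g i.
rewrite (simple_reflK cox) down ltnS leqnn invMg invgK (simple_reflV cox).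
by rewrite hactM hact_simple_refl (srefl_rt _ cox) hactN => ->.
Qed.

(** A simple reflection changes a single coordinate, so a positive root that
    becomes negative has no other coordinate and, having norm 1, is simple. *)
Lemma nonneg_srefl x t i :
  root_pair (x, t) -> nonneg x -> x != rt i -> nonneg (srefl i x).
Proof.
move=> xt x0; apply: contraNT => neg.
have sxt := root_pair_hact (sr i) xt; rewrite hact_simple_refl in sxt.
have x_off k : k != i -> x 0 k = 0.
  move=> ki; apply/eqP; rewrite eq_le (nonnegP _ x0) andbT -oppr_ge0.
  have : nonneg (- srefl i x) by rewrite (nonneg_rootN sxt).
  move=> /nonnegP/(_ k); rewrite /srefl !mxE (negPf ki) /=.
  by rewrite mulr0 subr0.
have Ex : x = x 0 i *: rt i.
  apply/rowP => k; rewrite !mxE eqxx /=.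
  by have [->|/x_off ->] := eqVneq k i; rewrite ?mulr1 ?mulr0.
have := root_pair_norm xt; rewrite Ex !coxBE (coxB_rt_refl _ cox) mulr1.
move: (nonnegP _ x0 i); rewrite -expr2 => xi0 /eqP.
by rewrite sqrp_eq1 // => /eqP ->; rewrite scale1r.
Qed.

(** If w is not 1, then w^-1 makes negative the simple root of the first letter
    of a reduced word of w. *)
Lemma hact_faithful w : (forall x, hact w x = x) -> w = 1%g.
Proof.
move=> w_id; have := word_prod_redword cox w; have := reduced_redword cox w.
case: (redword cox w) => [|i b]; first by rewrite word_prod_nil.
rewrite reduced_cons word_prod_cons => /andP[_ up] Ew.
set u := word_prod b in up Ew.
have := nonneg_rootN (root_pairP u^-1%g i); rewrite (nonneg_root up).
have -> : - hact u^-1%g (rt i) = rt i.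
  rewrite -[LHS]w_id -Ew hactM hactN hactVK hact_simple_refl -scaleN1r sreflZ.
  by rewrite (srefl_rt _ cox) scaleN1r opprK.
by rewrite nonneg_rt.
Qed.

Lemma root_pair_inj x t t' : root_pair (x, t) -> root_pair (x, t') -> t = t'.
Proof.
move=> xt xt'; have tt' : (t'^-1 * t = 1)%g.
  apply: hact_faithful => y.
  by rewrite hactM (root_pair_reflE _ xt) -(root_pair_reflE _ xt') hactK.
by apply/esym/eqP; rewrite eq_mulVg1 tt'.
Qed.

Lemma pos_root_reflection t : t \in reflections S ->
  exists2 x, root_pair (x, t) & nonneg x.
Proof.
case/imset2P => [u s _ sS ->]; have [i ->] : exists i, s = sr i.
  by exists (enum_rank_in sS s); rewrite /simple_refl enum_rankK_in.
have xt := root_pairP u i; have [x0|x0] := boolP (nonneg (hact u (rt i))).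
  by exists (hact u (rt i)).
exists (- hact u (rt i)); first exact: root_pairN.
by rewrite (nonneg_rootN xt).
Qed.

(** Every way to delete a letter from the word a, paired with the root and the
    reflection that this deletion amounts to: the shorter word represents the
    product of a by the reflection on the right (omits_prod). *)
Fixpoint omits a : seq ((h * W) * seq 'I_n) :=
  if a is i :: b then
    let u := word_prod b in
    ((hact u^-1%g (rt i), (u^-1 * sr i * u)%g), b)
      :: [seq (q.1, i :: q.2) | q <- omits b]
  else [::].

Definition invs a := [seq q.1 | q <- omits a].

Lemma invs_cons i b (u := word_prod b) :
  invs (i :: b) = (hact u^-1%g (rt i), (u^-1 * sr i * u)%g) :: invs b.
Proof. by rewrite /invs /= -map_comp. Qed.

Lemma omits_size a q : q \in omits a -> (size q.2).+1 = size a.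
Proof.
elim: a q => //= i b IHb q; rewrite inE => /predU1P[->//|/mapP[r rb ->]] /=.
by rewrite (IHb r).
Qed.

Lemma omits_prod a q : q \in omits a ->
  word_prod q.2 = (word_prod a * q.1.2)%g.
Proof.
elim: a q => //= i b IHb q; rewrite inE => /predU1P[->|/mapP[r rb ->]] /=.
  by rewrite word_prod_cons -!mulgA mulKVg (simple_reflK cox).
by rewrite !word_prod_cons (IHb r) // mulgA.
Qed.

Definition inversion w (p : h * W) :=
  [/\ root_pair p, nonneg p.1 & ~~ nonneg (hact w p.1)].

(** The strong exchange property: reading a from the right, a positive root that
    ends up negative changes sign at some letter, and it is the simple root of
    that letter just before. *)
Lemma inversion_invs a p : inversion (word_prod a) p -> p \in invs a.
Proof.
case: p => x t [xt x0]; elim: a => [|i b IHb] /=.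
  by rewrite word_prod_nil hact1 x0.
rewrite word_prod_cons hactM hact_simple_refl invs_cons inE => neg.
have [bx|/IHb ->] := boolP (nonneg (hact (word_prod b) x)); last exact: orbT.
have bxt := root_pair_hact (word_prod b) xt.
have Ex : hact (word_prod b) x = rt i.
  by apply: contraNeq neg; apply: nonneg_srefl bxt bx.
have Ex' : x = hact (word_prod b)^-1%g (rt i) by rewrite -Ex hactK.
rewrite Ex' in xt *; apply/orP; left; apply/eqP; congr (_, _).
apply: root_pair_inj xt _.
by have := root_pairP (word_prod b)^-1%g i; rewrite invgK.
Qed.

Lemma invs_inversion a p :
  reduced cox a -> p \in invs a -> inversion (word_prod a) p.
Proof.
elim: a p => // i b IHb p; rewrite reduced_cons => /andP[rb up].
have u0 := nonneg_root up.
have ui := root_pairP (word_prod b)^-1%g i; rewrite invgK in ui.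
rewrite invs_cons inE word_prod_cons => /predU1P[->|pb]; split=> //=.
- rewrite hactM hactVK hact_simple_refl (srefl_rt _ cox).
  by rewrite -(hact1 cox (rt i)) (nonneg_rootN (root_pairP _ i)) hact1 nonneg_rt.
- by have [] := IHb p rb pb.
- by have [] := IHb p rb pb.
case: p pb => x t pb; have [xt /= x0 bx] := IHb _ rb pb.
have bxt := root_pair_hact (word_prod b) xt.
rewrite hactM hact_simple_refl.
have sbxt := root_pair_hact (sr i) bxt; rewrite hact_simple_refl in sbxt.
rewrite -(nonneg_rootN sbxt) -scaleN1r -sreflZ scaleN1r.
apply: nonneg_srefl (root_pairN bxt) _ _; first by rewrite (nonneg_rootN bxt).
apply: contraTneq x0 => Ex.
rewrite -(hactK (R := R) cox (word_prod b) x) -[hact _ x]opprK Ex hactN.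
by rewrite (nonneg_rootN ui) u0.
Qed.

Lemma invs_uniq a : reduced cox a -> uniq (invs a).
Proof.
elim: a => // i b IHb; rewrite reduced_cons invs_cons /= => /andP[rb _].
rewrite IHb // andbT; apply/negP => /(invs_inversion rb)[_ _] /=.
by rewrite hactVK nonneg_rt.
Qed.

(** Both lists enumerate the inversions of the common product. This is what makes
    the sum in pdd_word_lin depend on the group element only. *)
Lemma invs_perm a b : reduced cox a -> reduced cox b ->
  word_prod a = word_prod b -> perm_eq (invs a) (invs b).
Proof.
move=> ra rb ab; apply: uniq_perm; rewrite ?invs_uniq // => p.
apply/idP/idP => [/(invs_inversion ra)|/(invs_inversion rb)].
  by rewrite ab; apply: inversion_invs.
by rewrite -ab; apply: inversion_invs.
Qed.

Lemma len_reflection_lt w x t : inversion w (x, t) -> (len (w * t)%g < len w)%N.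
Proof.
rewrite -{1}[w](word_prod_redword cox) => /inversion_invs/mapP[q qa Eq].
have := omits_prod qa; rewrite -Eq word_prod_redword /= => <-.
rewrite -(size_redword cox w) -(omits_size qa) ltnS.
exact: len_word.
Qed.

Lemma len_reflection_gt w x t : root_pair (x, t) -> nonneg x ->
  nonneg (hact w x) -> (len w < len (w * t)%g)%N.
Proof.
move=> xt x0 wx; have t2 := root_pairK xt.
rewrite -[w in X in (X < _)%N]mulg1 -t2 mulgA.
apply: (@len_reflection_lt _ x); split=> //=.
have wxt := root_pair_hact w xt.
by rewrite hactM (root_pair_hactN xt) hactN (nonneg_rootN wxt) wx.
Qed.

(** * Bruhat order and subwords *)

Lemma bruhat_le_refl w : bruhat_le cox w w.
Proof. exact: connect0. Qed.

Lemma bruhat_le_trans v u w :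
  bruhat_le cox u v -> bruhat_le cox v w -> bruhat_le cox u w.
Proof. exact: connect_trans. Qed.

Lemma bruhat_le_reflection w t : t \in reflections S ->
  (len w < len (w * t)%g)%N -> bruhat_le cox w (w * t)%g.
Proof.
move=> tS lt_w; apply: connect1; rewrite lt_w andbT.
by apply/existsP; exists t; rewrite tS eqxx.
Qed.

Lemma simple_reflection i : sr i \in reflections S.
Proof.
apply/imset2P; exists 1%g (sr i); rewrite ?inE ?enum_valP //.
by rewrite mul1g invg1 mulg1.
Qed.

(** It suffices to follow one step v < v t of a Bruhat chain. If t = s_i, then
    v s_i is the next element of the chain. Otherwise s_i keeps the root of t
    positive, and v s_i < v t s_i by the reflection s_i t s_i. *)
Lemma bruhat_le_simple v w i : bruhat_le cox v w ->
  bruhat_le cox (v * sr i)%g w \/ bruhat_le cox (v * sr i)%g (w * sr i)%g.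
Proof.
case/connectP => p; elim: p v => [|v' p IHp] v /=.
  by move=> _ ->; right; apply: bruhat_le_refl.
case/andP=> /andP[/existsP[t /andP[tS /eqP Ev']] lt_v] path_p Ew.
have le_v'w : bruhat_le cox v' w by apply/connectP; exists p.
have [Et|ti] := eqVneq t (sr i); first by left; rewrite -Et -Ev'.
have [x xt x0] := pos_root_reflection tS.
have six := root_pair_hact (sr i) xt; rewrite hact_simple_refl in six.
have sx0 : nonneg (srefl i x).
  apply: (nonneg_srefl xt x0); apply: contraNneq ti => Ex; apply/eqP.
  apply: root_pair_inj xt _; rewrite Ex.
  by have := root_pairP 1 i; rewrite hact1 mul1g invg1 mulg1.
have vx0 : nonneg (hact v x).
  apply: contraLR lt_v => vx; rewrite -leqNgt ltnW // Ev'.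
  exact: (@len_reflection_lt _ x).
have le_s : bruhat_le cox (v * sr i)%g (v' * sr i)%g.
  have -> : (v' * sr i = v * sr i * (sr i * t * (sr i)^-1))%g.
    by rewrite Ev' (simple_reflV cox) -!mulgA (simple_reflK cox).
  apply: bruhat_le_reflection.
    case/imset2P: tS => [u s _ sS ->]; apply/imset2P; exists (sr i * u)%g s => //.
    by rewrite invMg !mulgA.
  apply: len_reflection_gt six sx0 _.
  by rewrite hactM hact_simple_refl sreflK.
by have [le|le] := IHp v' path_p Ew; [left|right]; apply: bruhat_le_trans le.
Qed.

Lemma reduced_rcons b i : reduced cox (rcons b i) ->
  reduced cox b /\ bruhat_le cox (word_prod b) (word_prod b * sr i)%g.
Proof.
rewrite /reduced size_rcons -cats1 word_prod_cat word_prod_cons word_prod_nil.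
rewrite mulg1 => /eqP Eb.
have := len_word cox (redword cox (word_prod b) ++ [:: i]).
rewrite word_prod_cat word_prod_redword word_prod_cons word_prod_nil mulg1 Eb.
rewrite size_cat size_redword addn1 ltnS => le_b.
have eq_b : len (word_prod b) = size b.
  by apply/eqP; rewrite eqn_leq le_b len_word.
rewrite eq_b eqxx; split=> //; apply: bruhat_le_reflection.
  exact: simple_reflection.
by rewrite Eb eq_b.
Qed.

Lemma bruhat_le_mask a J : size J = size a -> reduced cox a ->
  bruhat_le cox (word_prod (mask J a)) (word_prod a).
Proof.
elim/last_ind: a J => [|b i IHb] J; first by rewrite mask0 bruhat_le_refl.
case/lastP: J => [|J c]; rewrite !size_rcons // => -[sJ] /reduced_rcons[rb le_b].
rewrite -!cats1 mask_cat // !word_prod_cat word_prod_cons word_prod_nil mulg1.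
have IH := IHb J sJ rb; case: c => /=.
  rewrite word_prod_cons word_prod_nil mulg1.
  have [le|//] := bruhat_le_simple i IH.
  exact: bruhat_le_trans le le_b.
by rewrite word_prod_nil mulg1; apply: bruhat_le_trans le_b.
Qed.

End Roots.

(** * Divided differences on polynomials *)

Section DividedDifferences.
Variables (R : realType) (W : finGroupType) (S : {set W}).
Variable cox : coxeter_system S.

Local Notation n := #|S|.
Local Notation h := 'rV[R]_n.
Local Notation rt := (simple_root R).
Local Notation sr := (@simple_refl W S).
Local Notation hact := (hact cox).
Local Notation pact := (pact cox).
Local Notation pdd := (pdd cox).
Local Notation Sh := {mpoly (complexes R)[n]}.
Local Notation real c := (c%:C%C : complexes R).
Implicit Types (i j : 'I_n) (x y z : h) (a b : seq 'I_n) (u v w t : W).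
Implicit Types (f g : Sh) (c : complexes R).

Lemma Sh_ind (P : Sh -> Prop) :
  P 1 -> (forall j, P 'X_j) -> (forall f g, P f -> P g -> P (f * g)) ->
  (forall c f g, P f -> P g -> P (c *: f + g)) -> forall f, P f.
Proof.
move=> P1 PX PM PL; apply: mpolyind.
  by have := PL (-1) 1 1 P1 P1; rewrite scaleN1r addNr.
by move=> c m p _ _ Pp; apply: PL => //; apply: mpolyX_ind.
Qed.

Lemma linD x y : lin (x + y) = lin x + lin y.
Proof.
rewrite /lin -big_split; apply: eq_bigr => i _ /=.
by rewrite !mxE rmorphD scalerDl.
Qed.

Lemma pactZ w c f : pact w (c *: f) = c *: pact w f.
Proof. exact: comp_mpolyZ. Qed.

Lemma pact1 w : pact w (1 : Sh) = 1.
Proof. exact: comp_mpoly1. Qed.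

Lemma pact_lin w x : pact w (lin x) = lin (hact w x).
Proof.
have -> : x = \sum_i x 0 i *: rt i.
  by rewrite {1}(row_sum_delta x).
have lin_sum (r : seq 'I_n) (F : 'I_n -> h) :
    lin (\sum_(i <- r) F i) = \sum_(i <- r) lin (F i).
  apply: (big_morph (@lin R W S) linD).
  by have := linB (0 : h) 0; rewrite !subrr.
have hact_sum (r : seq 'I_n) (F : 'I_n -> h) :
    hact w (\sum_(i <- r) F i) = \sum_(i <- r) hact w (F i).
  apply: (big_morph (hact w) (hactD cox w)).
  by rewrite -{1}(scale0r (0 : h)) hactZ scale0r.
rewrite lin_sum pact_sum hact_sum lin_sum; apply: eq_bigr => i _.
by rewrite hactZ !linZ lin_root pactZ pactX.
Qed.

Lemma pact_mulg u v f : pact (u * v)%g f = pact u (pact v f).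
Proof.
elim/Sh_ind: f => [|j|f g IHf IHg|c f g IHf IHg].
- by rewrite !pact1.
- by rewrite !pactX pact_lin hactM.
- by rewrite !pactM IHf IHg.
- by rewrite !pactD !pactZ IHf IHg.
Qed.

Lemma pact_id f : pact 1%g f = f.
Proof.
elim/Sh_ind: f => [|j|f g IHf IHg|c f g IHf IHg].
- exact: pact1.
- by rewrite pactX hact1 lin_root.
- by rewrite pactM IHf IHg.
- by rewrite pactD pactZ IHf IHg.
Qed.

Lemma pdd0 i : pdd i (0 : Sh) = 0.
Proof. by have := pddB cox i 0 (0 : Sh); rewrite !subrr. Qed.

Lemma pddD i : {morph (Defs.pdd (R := R) cox i) : f g / f + g}.
Proof.
have pddN g : pdd i (- g) = - pdd i g.
  by have := pddB cox i 0 g; rewrite pdd0 !sub0r.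
by move=> f g; rewrite -{1}[g]opprK pddB pddN opprK.
Qed.

Lemma pddZ i c f : pdd i (c *: f) = c *: pdd i f.
Proof.
apply/esym/pdd_uniq; rewrite -scalerAr pddP pactZ.
by rewrite scalerBr.
Qed.

Lemma pddM i f g :
  pdd i (f * g) = pdd i f * pact (sr i) g + f * pdd i g.
Proof.
apply/esym/pdd_uniq; rewrite mulrDr mulrA pddP mulrCA pddP pactM.
by rewrite mulrBl mulrBr addrC addrA subrK.
Qed.

Lemma pdd_lin i x : pdd i (lin x) = (real (2 * coxB x (rt i)))%:MP.
Proof.
apply/esym/pdd_uniq; rewrite pact_lin hact_simple_refl /srefl linB linZ lin_root.
by rewrite opprB addrC subrK -mul_mpolyC mulrC.
Qed.

Lemma pdd1 i : pdd i (1 : Sh) = 0.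
Proof. by apply/esym/pdd_uniq; rewrite mulr0 pact1 subrr. Qed.

(** Divided differences are invariant under the corresponding reflection. *)
Lemma pdd_pdd i f : pdd i (pdd i f) = 0.
Proof.
apply/esym/pdd_uniq; rewrite mulr0; apply/esym/eqP; rewrite subr_eq0 eq_sym.
have X0 : 'X_i != 0 :> Sh.
  apply/eqP => /(congr1 (mcoeff U_(i))).
  by rewrite mcoeffX eqxx mcoeff0 => /eqP; rewrite oner_eq0.
rewrite -(inj_eq (mulfI X0)); apply/eqP; apply: oppr_inj.
rewrite pddP opprB.
have := congr1 (pact (sr i)) (pddP cox i f).
rewrite pactB -pact_mulg (simple_refl2 cox) pact_id pactM => <-.
rewrite pactX hact_simple_refl (srefl_rt _ cox) -(scaleN1r (rt i)) linZ lin_root.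
by rewrite rmorphN rmorph1 scaleN1r mulNr.
Qed.

Definition pdd_word a f : Sh := foldr (@Defs.pdd R W S cox) f a.

Lemma pdd_wordL a c f g :
  pdd_word a (c *: f + g) = c *: pdd_word a f + pdd_word a g.
Proof. by elim: a => //= i a ->; rewrite pddD pddZ. Qed.

Lemma pdd_word0 a : pdd_word a 0 = 0.
Proof. by elim: a => //= i a ->; apply: pdd0. Qed.

Lemma pdd_word1 a : (0 < size a)%N -> pdd_word a 1 = 0.
Proof.
case/lastP: a => [|a i _]; first discriminate.
rewrite /pdd_word foldr_rcons (pdd1 i).
exact: (pdd_word0 a).
Qed.

(** The Leibniz rule for a linear factor: the factor is either acted on by every
    letter, or is differentiated once, to a scalar, by a letter that is thereby
    lost for f. *)
Lemma pdd_word_lin a f x :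
  pdd_word a (f * lin x) = pdd_word a f * lin (hact (word_prod a) x) +
    \sum_(q <- omits R cox a) real (2 * coxB x q.1.1) *: pdd_word q.2 f.
Proof.
elim: a => [|i b IHb] /=.
  by rewrite big_nil addr0 word_prod_nil hact1.
have pdd_sum (r : seq ((h * W) * seq 'I_n)) (F : _ -> Sh) :
    pdd i (\sum_(q <- r) F q) = \sum_(q <- r) pdd i (F q).
  exact: (big_morph _ (pddD i) (pdd0 i)).
rewrite IHb pddD pddM pact_lin -hactM -word_prod_cons pdd_lin -addrA.
congr (_ + _); rewrite big_cons big_map pdd_sum; congr (_ + _); last first.
  by apply: eq_bigr => q _; rewrite pddZ.
rewrite mulrC mul_mpolyC; congr (real (2 * _) *: _).
by rewrite -[x in RHS](hactK cox (word_prod b)) coxB_hact.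
Qed.

(** Both claims about words of length l, that reduced words of the same element
    give the same operator and that other words give 0, use only the first
    claim for shorter words. *)
Section WellDefined.
Variable l : nat.
Hypothesis IHl : forall a b, reduced cox a -> reduced cox b ->
  word_prod a = word_prod b -> (size a < l)%N -> pdd_word a =1 pdd_word b.

(** If b is reduced and i shortens its product, then b may be replaced by a
    reduced word that starts with i, and two equal consecutive divided
    differences compose to 0. *)
Lemma pdd_word_nonreduced a f :
  (size a <= l)%N -> ~~ reduced cox a -> pdd_word a f = 0.
Proof.
elim: a => [|i b IHb] /= lt_bl.
  by rewrite /reduced -leqn0 len_word.
rewrite reduced_cons; case: (boolP (reduced cox b)) => [rb /= down|nrb _].
  have Eb := len_simple_down down.
  set c := i :: redword cox (sr i * word_prod b)%g.
  have Ec : word_prod b = word_prod c.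
    by rewrite word_prod_cons word_prod_redword (simple_reflK cox).
  have rc : reduced cox c by rewrite /reduced -Ec Eb /= size_redword.
  by rewrite (IHl rb rc Ec lt_bl) /= pdd_pdd.
by rewrite IHb ?pdd0 // ltnW.
Qed.

(** By pdd_word_lin and the hypotheses on shorter words, the two operators have
    the same commutation rule with linear forms. As both vanish at 1, they agree
    on all polynomials. *)
Lemma pdd_word_step a b : reduced cox a -> reduced cox b ->
  word_prod a = word_prod b -> size a = l -> pdd_word a =1 pdd_word b.
Proof.
move=> ra rb ab sa.
have sb : size b = l by rewrite -sa -(eqP ra) -(eqP rb) ab.
have nonred := pdd_word_nonreduced.
case: l IHl nonred sa sb =>
  [_ _ /size0nil -> /size0nil -> //|k IHk nonred sa sb] f.
(* The operator of a word of length k, as a function of its product only: a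
   nonreduced word has a product of smaller length. *)
pose D u g := if len cox u == k then pdd_word (redword cox u) g else 0.
have DE d g : size d = k -> pdd_word d g = D (word_prod d) g.
  move=> sd; rewrite /D -[k]sd -/(reduced cox d).
  have [rd|nrd] := boolP (reduced cox d).
    apply: (IHk _ _ rd (reduced_redword cox _)); last by rewrite sd.
    by rewrite word_prod_redword.
  by rewrite nonred ?sd.
have linE d g x : size d = k.+1 -> pdd_word d (g * lin x) =
    pdd_word d g * lin (hact (word_prod d) x) +
    \sum_(p <- invs R cox d) real (2 * coxB x p.1) *: D (word_prod d * p.2)%g g.
  move=> sd; rewrite pdd_word_lin big_map; congr (_ + _).
  apply: eq_big_seq => q qd; rewrite DE ?(omits_prod qd) //.
  by apply: succn_inj; rewrite (omits_size qd).
have diffE g x : pdd_word a g = pdd_word b g ->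
    pdd_word a (g * lin x) = pdd_word b (g * lin x).
  move=> Eg; rewrite (linE a _ _ sa) (linE b _ _ sb) Eg ab; congr (_ + _).
  by apply: perm_big; apply: invs_perm.
suff E g : pdd_word a g = pdd_word b g ->
    pdd_word a (g * f) = pdd_word b (g * f).
  by rewrite -[f]mul1r E // !pdd_word1 ?sa ?sb.
elim/Sh_ind: f g => [|j|f f' IHf IHf'|c f f' IHf IHf'] g Eg.
- by rewrite mulr1.
- by rewrite -(lin_root R j) diffE.
- by rewrite mulrA; apply/IHf'/IHf.
- by rewrite mulrDr -scalerAr !pdd_wordL IHf ?IHf'.
Qed.

End WellDefined.

Lemma pdd_word_reduced a b : reduced cox a -> reduced cox b ->
  word_prod a = word_prod b -> pdd_word a =1 pdd_word b.
Proof.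
move: {2}(size a) (erefl (size a)) => l; move: a b.
have [m] := ubnP l; elim: m l => // m IHm l lt_lm a b sa ra rb ab.
apply: (pdd_word_step (l := l)) => // c d rc rd cd lt_cl.
by apply: (IHm (size c)); rewrite // (leq_trans lt_cl).
Qed.

Lemma pdd_word_eq0 a f : ~~ reduced cox a -> pdd_word a f = 0.
Proof.
apply: (pdd_word_nonreduced (l := size a)) => // b c rb rc bc _.
exact: pdd_word_reduced.
Qed.

End DividedDifferences.

(** * The coinvariant algebra *)

Section Coinvariants.
Variables (R : realType) (W : finGroupType) (S : {set W}).
Variable cox : coxeter_system S.

Local Notation n := #|S|.
Local Notation sr := (@simple_refl W S).
Local Notation S_W := (coinvariant R cox).
Local Notation Sh := {mpoly (complexes R)[n]}.
Local Notation cl := (@coinv_class R W S cox).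
Implicit Types (i : 'I_n) (a b : seq 'I_n) (u v w : W) (x y : S_W).

Lemma coinv_ind (P : S_W -> Prop) : (forall f, P (cl f)) -> forall x, P x.
Proof. by move=> Pcl x; rewrite -(coinv_reprK x). Qed.

Lemma coinv_classD : {morph cl : f g / f + g}.
Proof. exact: rmorphD. Qed.

Lemma coinv_class0 : cl 0 = 0.
Proof. exact: rmorph0. Qed.

Lemma coinv_actM u v x : coinv_act (u * v)%g x = coinv_act u (coinv_act v x).
Proof. by elim/coinv_ind: x => f; rewrite !coinv_act_class pact_mulg. Qed.

Lemma coinv_actVK v x : coinv_act v (coinv_act v^-1%g x) = x.
Proof.
rewrite -coinv_actM mulgV; elim/coinv_ind: x => f.
by rewrite coinv_act_class pact_id.
Qed.

Lemma ddD i x y : dd i (x + y) = dd i x + dd i y.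
Proof.
elim/coinv_ind: x => f; elim/coinv_ind: y => g.
by rewrite -coinv_classD !dd_class pddD coinv_classD.
Qed.

Lemma dd0 i : dd i (0 : S_W) = 0.
Proof. by rewrite -coinv_class0 dd_class pdd0. Qed.

Lemma ddM i x y :
  dd i (x * y) = dd i x * coinv_act (sr i) y + x * dd i y.
Proof.
elim/coinv_ind: x => f; elim/coinv_ind: y => g.
rewrite -coinv_classM !dd_class coinv_act_class pddM.
by rewrite coinv_classD !coinv_classM.
Qed.

Lemma dd_word_class a f : dd_word a (cl f) = cl (pdd_word cox a f).
Proof.
elim: a => [|i a IHa]; first by [].
by rewrite /= IHa dd_class.
Qed.

Lemma dd_word_reduced a x :
  reduced cox a -> dd_word a x = dd_elt (word_prod a) x.
Proof.
move=> ra; elim/coinv_ind: x => f; rewrite /dd_elt !dd_word_class.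
rewrite (pdd_word_reduced _ (reduced_redword cox (word_prod a))) //.
by rewrite word_prod_redword.
Qed.

Lemma dd_word_eq0 a x : ~~ reduced cox a -> dd_word a x = 0.
Proof.
move=> na; elim/coinv_ind: x => f.
by rewrite dd_word_class pdd_word_eq0 // coinv_class0.
Qed.

Lemma big_mask_cons (V : nmodType) m (F : bitseq -> V) :
  \sum_(J : m.+1.-tuple bool) F J =
  \sum_(J : m.-tuple bool) (F (true :: J) + F (false :: J)).
Proof.
rewrite big_split /=.
rewrite (reindex (fun p : bool * m.-tuple bool => [tuple of p.1 :: p.2])) /=.
  by rewrite -(pair_big xpredT xpredT (fun c (J : m.-tuple bool) => F (c :: J)))
    /= big_bool.
exists (fun J => (thead J, [tuple of behead J])) => [[c J]|J] _ /=.
  by congr (_, _); apply: val_inj.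
by case/tupleP: J => c J; apply: val_inj.
Qed.

(** At each letter the Leibniz rule ddM either differentiates the first factor
    and reflects the second, or only differentiates the second. *)
Lemma dd_word_leibniz a x y :
  dd_word a (x * y) =
  \sum_(J : (size a).-tuple bool) dd_word (mask J a) x * dd_sub a J y.
Proof.
elim: a => [|i a IHa] /=.
  rewrite (big_pred1 [tuple]) //= => J; apply/esym/eqP.
  exact: tuple0.
rewrite (big_mask_cons _
  (fun J => dd_word (mask J (i :: a)) x * dd_sub (i :: a) J y)).
rewrite IHa (big_morph _ (ddD i) (dd0 i)); apply: eq_bigr => J _.
by rewrite ddM.
Qed.

End Coinvariants.

Theorem theorem1p9 (R : realType) (W : finGroupType) (S : {set W})
    (cox : coxeter_system S) (w : W) (phi psi : coinvariant R cox) :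
  dd_elt w (phi * psi) =
  \sum_(v : W | bruhat_le cox v w)
    dd_elt v phi * coinv_act v (skew_dd w v psi).
Proof.
rewrite {1}/dd_elt dd_word_leibniz; set a := redword cox w.
under [RHS]eq_bigr => v le_vw.
  rewrite /skew_dd le_vw coinv_actVK mulr_sumr; over.
(* Each mask J contributes to the single v for which it selects a reduced word,
   if there is one. *)
rewrite (exchange_big_dep xpredT) //=; apply: eq_bigr => J _.
have [rJ|nrJ] := boolP (reduced cox (mask J a)); last first.
  rewrite dd_word_eq0 // mul0r big_pred0 // => v; apply/negP.
  case/and3P=> _ /eqP Ev sz; case/negP: nrJ.
  by rewrite /reduced Ev eq_sym.
rewrite (big_pred1 (word_prod (mask J a))) ?dd_word_reduced // => v.
rewrite /reduced_expr; apply/and3P/eqP => [[_ /eqP]//|->]; split=> //.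
  rewrite -[w in bruhat_le _ _ w](word_prod_redword cox).
  by apply: (bruhat_le_mask R) (reduced_redword cox w); rewrite size_tuple.
by rewrite eq_sym.
Qed.
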